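(* Let $A_1$ be the $2$-dimensional complex pre-Lie algebra with basis $\{e_1,e_2\}$ and product $e_1\cdot e_1=e_1+e_2$, $e_2\cdot e_1=e_2$, $e_1\cdot e_2=0$, $e_2\cdot e_2=0$. The averaging operators on $A_1$ are exactly the linear maps whose matrix is one of $P_1=\begin{pmatrix}\vartheta_{22}&0\\0&\vartheta_{22}\end{pmatrix}$ with $\vartheta_{22}\in\mathbb{C}$, or $P_2=\begin{pmatrix}0&0\\ \vartheta_{21}&0\end{pmatrix}$ with $\vartheta_{21}\in\mathbb{C}$ (i.e. $P_2(e_1)=\vartheta_{21}e_2$, $P_2(e_2)=0$).
   Context: An averaging operator on a complex pre-Lie algebra $(A,\cdot)$ is a $\mathbb{C}$-linear map $P:A\to A$ such that $P(x)\cdot P(y)=P\big(x\cdot P(y)\big)=P\big(P(x)\cdot y\big)$ for all $x,y\in A$. Matrix convention: the $j$-th column of the matrix of $P$ gives the coordinates of $P(e_j)$ in the basis $(e_1,e_2)$. *)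

(* Defs.v *)
From HB Require Import structures.
From mathcomp Require Import all_boot all_order all_algebra.
From mathcomp Require Import reals.
From mathcomp Require Import complex ring.

Set Implicit Arguments.
Unset Strict Implicit.
Unset Printing Implicit Defensive.

Import GRing.Theory.
Local Open Scope ring_scope.

(* The pre-Lie identity is the left-symmetry of the associator; the algebra   *)
(* [A1] below satisfies the right-symmetric one as well ([A1_rsym]).          *)
HB.mixin Record Lmodule_isPreLie (K : comNzRingType) V of GRing.Lmodule K V := {
  plmul : V -> V -> V;
  plmul_linear_r : forall x : V, linear (plmul x);
  plmul_linear_l : forall y : V, linear (plmul^~ y);
  plmul_lsym : forall x y z : V,
    plmul (plmul x y) z - plmul x (plmul y z) =
    plmul (plmul y x) z - plmul y (plmul x z)
}.

#[short(type="preLieAlgType")]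
HB.structure Definition PreLie (K : comNzRingType) :=
  { V of GRing.Lmodule K V & Lmodule_isPreLie K V }.

Notation "x \pl y" := (plmul x y) (at level 40, left associativity) : ring_scope.

Definition averaging (K : comNzRingType) (A : preLieAlgType K)
    (P : {linear A -> A}) : Prop :=
  forall x y : A,
    P x \pl P y = P (x \pl P y) /\ P (x \pl P y) = P (P x \pl y).

(* The carrier of [A1] is the space of coordinate columns over [R[i]]; the    *)
(* basis vectors are indexed from 0, so e_1, e_2 are [e1 R], [e2 R].          *)
Definition A1 (R : realType) : Type := 'cV[R[i]]_2.
HB.instance Definition _ (R : realType) := GRing.Lmodule.on (A1 R).

Definition e1 (R : realType) : A1 R := delta_mx 0 0.
Definition e2 (R : realType) : A1 R := delta_mx 1 0.

Definition A1_basis (R : realType) (i : 'I_2) : A1 R :=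
  if i == 0 then e1 R else e2 R.

Definition A1_table (R : realType) (i j : 'I_2) : A1 R :=
  match val i, val j with
  | 0%N, 0%N => e1 R + e2 R
  | 1%N, 0%N => e2 R
  | _, _ => 0
  end.

Definition A1_coord (R : realType) (x : A1 R) (i : 'I_2) : R[i] :=
  (x : 'cV[R[i]]_2) i 0.

Definition A1_mul (R : realType) (x y : A1 R) : A1 R :=
  \sum_(i < 2) \sum_(j < 2)
    (A1_coord x i * A1_coord y j) *: A1_table R i j.

Lemma A1_coordK (R : realType) (x : A1 R) :
  x = \sum_(i < 2) A1_coord x i *: A1_basis R i.
Proof.
apply/matrixP => k l; rewrite (ord1 l) big_ord_recl big_ord1.
rewrite /A1_basis /= /e1 /e2 /A1_coord !mxE.
case: k => [[|[|//]] kP] /=; rewrite !(mulr1, mulr0, addr0, add0r) //;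
  by congr (x _ _); apply/val_inj.
Qed.

Lemma A1_coordP (R : realType) (a : R[i]) (x y : A1 R) (i : 'I_2) :
  A1_coord (a *: x + y) i = a * A1_coord x i + A1_coord y i.
Proof. by rewrite /A1_coord !mxE. Qed.

Lemma A1_mul_linear_r (R : realType) (x : A1 R) : linear (A1_mul x).
Proof.
move=> a y z; rewrite /A1_mul scaler_sumr -big_split /=.
apply: eq_bigr => i _; rewrite scaler_sumr -big_split /=.
apply: eq_bigr => j _.
by rewrite A1_coordP mulrDr scalerDl scalerA mulrCA.
Qed.

Lemma A1_mul_linear_l (R : realType) (y : A1 R) :
  linear (fun x => A1_mul x y).
Proof.
move=> a x z; rewrite /A1_mul scaler_sumr -big_split /=.
apply: eq_bigr => i _; rewrite scaler_sumr -big_split /=.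
apply: eq_bigr => j _.
by rewrite A1_coordP mulrDl scalerDl scalerA mulrA.
Qed.

Lemma A1_mul_coord0 (R : realType) (x y : A1 R) :
  A1_coord (A1_mul x y) 0 = A1_coord x 0 * A1_coord y 0.
Proof.
rewrite /A1_mul !big_ord_recl !big_ord0 /A1_table /= /e1 /e2.
by rewrite {1}/A1_coord !mxE /= !(mulr0, mulr1, addr0).
Qed.

Lemma A1_mul_coord1 (R : realType) (x y : A1 R) :
  A1_coord (A1_mul x y) 1 = (A1_coord x 0 + A1_coord x 1) * A1_coord y 0.
Proof.
rewrite /A1_mul !big_ord_recl !big_ord0 /A1_table /= /e1 /e2.
rewrite {1}/A1_coord !mxE /= !(mulr0, mulr1, addr0, add0r) mulrDl.
by congr (_ + A1_coord x _ * _); apply/val_inj.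
Qed.

Lemma A1_eqP (R : realType) (x y : A1 R) :
  A1_coord x 0 = A1_coord y 0 -> A1_coord x 1 = A1_coord y 1 -> x = y.
Proof.
move=> h0 h1; apply/matrixP => k l; rewrite (ord1 l).
by case: (unliftP 0 k) => [j|] -> //; rewrite (ord1 j) (_ : lift 0 0 = 1) //; apply/val_inj.
Qed.

Lemma A1_mul_lsym (R : realType) (x y z : A1 R) :
  A1_mul (A1_mul x y) z - A1_mul x (A1_mul y z) =
  A1_mul (A1_mul y x) z - A1_mul y (A1_mul x z).
Proof.
have coordB (u v : A1 R) i : A1_coord (u - v) i = A1_coord u i - A1_coord v i.
  by rewrite /A1_coord !mxE.
by apply: A1_eqP; rewrite !coordB !(A1_mul_coord0, A1_mul_coord1); ring.
Qed.

Lemma A1_rsym (R : realType) (x y z : A1 R) :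
  A1_mul (A1_mul x y) z - A1_mul x (A1_mul y z) =
  A1_mul (A1_mul x z) y - A1_mul x (A1_mul z y).
Proof.
have coordB (u v : A1 R) i : A1_coord (u - v) i = A1_coord u i - A1_coord v i.
  by rewrite /A1_coord !mxE.
by apply: A1_eqP; rewrite !coordB !(A1_mul_coord0, A1_mul_coord1); ring.
Qed.

HB.instance Definition _ (R : realType) :=
  Lmodule_isPreLie.Build R[i] (A1 R)
    (@A1_mul_linear_r R) (@A1_mul_linear_l R) (@A1_mul_lsym R).

Lemma A1_products (R : realType) :
  [/\ e1 R \pl e1 R = e1 R + e2 R, e2 R \pl e1 R = e2 R,
      e1 R \pl e2 R = 0 & e2 R \pl e2 R = 0].
Proof.
have coordD (u v : A1 R) i : A1_coord (u + v) i = A1_coord u i + A1_coord v i.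
  by rewrite /A1_coord !mxE.
have coord0 i : A1_coord (0 : A1 R) i = 0 by rewrite /A1_coord mxE.
have h : (A1_coord (e1 R) 0 = 1) * (A1_coord (e1 R) 1 = 0) *
         (A1_coord (e2 R) 0 = 0) * (A1_coord (e2 R) 1 = 1).
  by rewrite /A1_coord !mxE.
by split; apply: A1_eqP; rewrite ?coordD ?coord0 /plmul /=
  !(A1_mul_coord0, A1_mul_coord1) !h; ring.
Qed.

(* Column [j] holds the coordinates of the image of the [j]-th basis vector   *)
(* (MathComp's own [lin1_mx] uses the transposed convention).                 *)
Definition A1_matrix (R : realType) (P : {linear A1 R -> A1 R}) : 'M[R[i]]_2 :=
  \matrix_(i < 2, j < 2) A1_coord (P (A1_basis R j)) i.

Definition mx22 (K : nzRingType) (a b c d : K) : 'M[K]_2 :=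
  \matrix_(i < 2, j < 2) nth 0 (nth [::] [:: [:: a; b]; [:: c; d]] i) j.

(* Main.v *)
Require Import Defs.
From mathcomp Require Import all_boot all_order all_algebra.
From mathcomp Require Import reals.
From mathcomp Require Import complex.
From mathcomp Require Import ring.

(** In coordinates, the product of [A1] is
    [(x0, x1) . (y0, y1) = (x0 * y0, (x0 + x1) * y0)].  For a linear map with
    matrix [(a, b; c, d)] the averaging identities on pairs of basis vectors
    therefore become polynomial equations in the entries, and these amount to
    [b = 0], [a (a - d) = 0], [d (a - d) = 0] and [c d = 0]
    ([averaging_mx22P]).  Over a field, either [a = 0], and then [d ^ 2 = 0]
    forces [d = 0] and leaves [c] free, or [a = d] is nonzero and [c = 0]. *)

Import GRing.Theory.
Local Open Scope ring_scope.

Lemma mx22_eta (K : nzRingType) (M : 'M[K]_2) :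
  M = mx22 (M 0 0) (M 0 1) (M 1 0) (M 1 1).
Proof.
apply/matrixP => i j; rewrite !mxE.
case: i => [[|[|//]] iP]; case: j => [[|[|//]] jP] /=;
  by congr (M _ _); apply/val_inj.
Qed.

(** With [u = v] a known identity, this reduces [x = y] to a ring identity:
    [x - y] is the difference of the sides of [u = v]. *)
Lemma eq_of_subr (V : zmodType) (u v x y : V) :
  u = v -> x - y = v - u -> x = y.
Proof. by move=> -> /eqP; rewrite subrr subr_eq0 => /eqP. Qed.

Lemma A1_coord_basis (R : realType) :
  (A1_coord (e1 R) 0 = 1) * (A1_coord (e1 R) 1 = 0) *
  (A1_coord (e2 R) 0 = 0) * (A1_coord (e2 R) 1 = 1).
Proof. by rewrite /A1_coord !mxE. Qed.

(** The images under [P] of coordinate columns are read off the matrix, so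
    that [A1_matrix P] determines [P]. *)
Lemma A1_coord_mx22 (R : realType) (P : {linear A1 R -> A1 R})
    (a b c d : R[i]) (x : A1 R) :
  A1_matrix P = mx22 a b c d ->
  (A1_coord (P x) 0 = a * A1_coord x 0 + b * A1_coord x 1) *
  (A1_coord (P x) 1 = c * A1_coord x 0 + d * A1_coord x 1).
Proof.
move=> PE.
have entry (i j : 'I_2) : A1_coord (P (A1_basis R j)) i = mx22 a b c d i j.
  by rewrite -PE mxE.
have coordP (i : 'I_2) : A1_coord (P x) i =
    mx22 a b c d i 0 * A1_coord x 0 + mx22 a b c d i 1 * A1_coord x 1.
  rewrite [in LHS](A1_coordK x) big_ord_recl big_ord1.
  have -> : lift ord0 ord0 = 1 :> 'I_2 by apply/val_inj.
  have coordZ k (u : A1 R) : A1_coord (k *: u) i = k * A1_coord u i.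
    by rewrite /A1_coord mxE.
  by rewrite linearP linearZ /= A1_coordP coordZ !entry mulrC [X in _ + X]mulrC.
by rewrite !coordP !mxE.
Qed.

(** Averaging maps in terms of matrix entries: the equations are necessary by
    evaluating at the basis vectors, and sufficient because both coordinates of
    each averaging defect lie in the ideal that they generate. *)
Lemma averaging_mx22P (R : realType) (P : {linear A1 R -> A1 R})
    (a b c d : R[i]) :
  A1_matrix P = mx22 a b c d ->
  averaging P <->
  [/\ b = 0, a * (a - d) = 0, d * (a - d) = 0 & c * d = 0].
Proof.
move=> PE.
have cP x := A1_coord_mx22 R P a b c d x PE.
have c0 (x y : A1 R) : A1_coord (x \pl y) 0 = A1_coord x 0 * A1_coord y 0.
  exact: A1_mul_coord0.
have c1 (x y : A1 R) :
    A1_coord (x \pl y) 1 = (A1_coord x 0 + A1_coord x 1) * A1_coord y 0.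
  exact: A1_mul_coord1.
split=> [avP | [b0 ad dd cd] x y].
- have cE := (cP, c0, c1, A1_coord_basis R, mulr1, mulr0, addr0, add0r).
  have left x y i : A1_coord (P x \pl P y) i = A1_coord (P (x \pl P y)) i.
    by have [-> _] := avP x y.
  have right x y i : A1_coord (P x \pl P y) i = A1_coord (P (P x \pl y)) i.
    by have [-> ->] := avP x y.
  (* the first coordinate at (e1, e2) reads a b = a b + b ^ 2 *)
  have b0 : b = 0.
    apply/eqP; rewrite -sqrf_eq0; apply/eqP.
    by apply: (eq_of_subr _ _ _ _ _ (left (e1 R) (e2 R) 0)); rewrite !cE; ring.
  subst b.
  have ad : a * (a - d) = 0.
    by apply: (eq_of_subr _ _ _ _ _ (esym (left (e1 R) (e1 R) 1)));
      rewrite !cE; ring.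
  split=> //.
    by apply: (eq_of_subr _ _ _ _ _ (esym (right (e2 R) (e1 R) 1)));
      rewrite !cE; ring.
  (* the second coordinate at (e1, e1) reads (a + c) a = c a + d (a + c),
     that is a (a - d) = c d *)
  by apply: (eq_of_subr _ _ _ _ _
    (congr2 +%R (right (e1 R) (e1 R) 1) (esym ad))); rewrite !cE; ring.
- subst b; split; apply: A1_eqP; rewrite !(cP, c0, c1); [ring| |ring|].
  (* the sides differ by x0 y0 a (a - d) *)
  + pose f t := A1_coord x 0 * A1_coord y 0 * t.
    by apply: (eq_of_subr _ _ _ _ _ (congr1 f (esym ad))); rewrite /f; ring.
  (* the sides differ by x1 y0 d (a - d) - x0 y0 c d *)
  + pose f s t := A1_coord x 1 * A1_coord y 0 * s -
                  A1_coord x 0 * A1_coord y 0 * t.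
    by apply: (eq_of_subr _ _ _ _ _ (congr2 f (esym dd) (esym cd)));
      rewrite /f; ring.
Qed.

Theorem theorem2p5 (R : realType) (P : {linear A1 R -> A1 R}) :
  averaging P <->
  (exists theta22 : R[i], A1_matrix P = mx22 theta22 0 0 theta22) \/
  (exists theta21 : R[i], A1_matrix P = mx22 0 0 theta21 0).
Proof.
split=> [|[[t tE]|[t tE]]].
- have PE := mx22_eta _ (A1_matrix P).
  rewrite (averaging_mx22P _ _ _ _ _ _ PE); move: PE.
  set a := A1_matrix P 0 0; set b := A1_matrix P 0 1.
  set c := A1_matrix P 1 0; set d := A1_matrix P 1 1.
  move=> -> [-> /eqP ad /eqP dd /eqP cd].
  have [a0|a0] := eqVneq a 0.
  + move: dd; rewrite a0 sub0r mulrN oppr_eq0 mulf_eq0 orbb => /eqP ->.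
    by right; exists c.
  + move: ad; rewrite mulf_eq0 (negPf a0) subr_eq0 /= => /eqP da.
    move: cd; rewrite -da mulf_eq0 (negPf a0) orbF => /eqP ->.
    by left; exists a.
- by apply/(averaging_mx22P _ _ _ _ _ _ tE); rewrite subrr !mulr0 mul0r.
- by apply/(averaging_mx22P _ _ _ _ _ _ tE); rewrite subrr !mulr0.
Qed.
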